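(* Let $G$ be a finite $2$-group of order $2^n$, $n\geq 3$, which is not elementary abelian. Then for every $0\leq k\leq n$, $$s_k(G)\leq s_k(D_8\times C_2^{n-3}).$$
   Context: For a finite $p$-group $G$ of order $p^n$ and $0\le k\le n$, $s_k(G)$ denotes the number of subgroups of $G$ of order $p^k$. $D_8$ is the dihedral group of order $8$ and $C_2^{m}$ is the elementary abelian $2$-group of order $2^m$. *)

(* Defs.v *)
From mathcomp Require Import all_boot all_fingroup all_algebra all_solvable.
Set Implicit Arguments. Unset Strict Implicit. Unset Printing Implicit Defensive.
Local Open Scope group_scope.

Definition nsubgroups_of_order (gT : finGroupType) (p k : nat) (G : {set gT}) : nat :=
  #|[set H : {group gT} | (H \subset G) && (#|H| == p ^ k)%N]|.

(* C_2 realized as the additive group of 'I_2 (integers mod 2). *)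
Definition C2_gtype : finGroupType := 'I_2.

(* C_2^m: the direct power of m copies of C_2 (finite functions 'I_m -> C_2,
   with pointwise group law). *)
Definition C2pow_gtype (m : nat) : finGroupType :=
  {dffun forall i : 'I_m, C2_gtype}.

Definition D8xC2pow_gtype (m : nat) : finGroupType :=
  ('D_8 * C2pow_gtype m)%type.

(* Main.v *)
(** Write e(n,k) for the number of subgroups of order 2^k of C_2^n.

    If Z is a central subgroup of order 2, then s_k(G) <= s_k(G/Z x C_2): the
    subgroups of G that contain Z correspond to subgroups of G/Z, and those that
    avoid Z are complements of Z in their product with Z.  When Z lies in Phi(G),
    this halves the order of the Frattini subgroup, so one may assume that
    Z = Phi(G) has order 2.

    In that case, choose a in G with a^2 <> 1 and let A = <a> and C = C_G(a), of
    index at most 2.  A subgroup H avoiding Z is a complement of Z in the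
    elementary abelian group L = HZ, and the number w of such complements depends
    only on k.  Next, L A is a subgroup P containing A.  If P <= C, then P
    determines L, since x and x a cannot both square to 1; otherwise there are
    at most two choices for L, distinguished by whether they contain a fixed
    element of P \ C.  Counting the P in G/A and C/A yields
      s_k(G) <= e(n-1,k-1) + w (2 e(n-2,k) - e(n-3,k)).
    The group D_8 x C_2^(n-3) reaches this value, already by counting the
    subgroups of its two elementary abelian subgroups of index 2. *)

Require Import Defs.
From mathcomp Require Import all_boot all_fingroup all_algebra all_solvable.
Local Open Scope group_scope.

(** * Counting the subgroups that contain or avoid a fixed subgroup *)

Section Counting.
Variables (gT : finGroupType) (p : nat).
Implicit Types G H K L Z : {group gT}.

Definition over_subgroups k (Z G : {set gT}) : {set {group gT}} :=
  [set H : {group gT} | [&& Z \subset H, H \subset G & #|H| == p ^ k]%N].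

Definition avoiding_subgroups k (Z G : {set gT}) : {set {group gT}} :=
  [set H : {group gT} | [&& ~~ (Z \subset H), H \subset G & #|H| == p ^ k]%N].

Lemma nsubgroups_split k (Z G : {set gT}) :
  nsubgroups_of_order p k G
    = (#|over_subgroups k Z G| + #|avoiding_subgroups k Z G|)%N.
Proof.
rewrite /nsubgroups_of_order -(cardsID [set H : {group gT} | Z \subset H]).
congr (_ + _)%N; apply: eq_card => H; rewrite !inE 1?andbC //.
Qed.

Lemma card_over_subgroups j k Z G :
  Z <| G -> #|Z| = (p ^ j)%N -> (0 < p)%N ->
  #|over_subgroups (j + k) Z G| = nsubgroups_of_order p k (G / Z).
Proof.
move=> nsZG oZ p_gt0; rewrite /nsubgroups_of_order.
have inj : injective (fun K : {group coset_of Z} => (coset Z @*^-1 K)%G).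
  move=> K1 K2 /(congr1 val) /= eqK; apply/val_inj => /=.
  by rewrite -(cosetpreK K1) eqK cosetpreK.
rewrite -(card_imset _ inj); apply: eq_card => H; rewrite inE.
apply/and3P/imsetP => [[sZH sHG oH]|[K /[!inE] /andP[sKG /eqP oK] ->]].
  have nsZH := normalS sZH sHG nsZG.
  exists (H / Z)%G; last by apply/val_inj; rewrite /= quotientGK.
  rewrite inE quotientS //= card_quotient ?normal_norm // -divgS // (eqP oH) oZ.
  by rewrite expnD mulKn // expn_gt0 p_gt0.
by rewrite /= sub_cosetpre sub_cosetpre_quo // card_cosetpre oZ oK expnD.
Qed.

(** Since [Z] has prime order, a subgroup [H] avoiding it meets it trivially, so [H <*> Z] has order
    [p ^ k.+1]. The sum sorts the [H] by this product [L]. *)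
Lemma card_avoiding_subgroups k Z G :
  Z <| G -> #|Z| = p -> prime p ->
  #|avoiding_subgroups k Z G|
    = (\sum_(L in over_subgroups k.+1 Z G) #|avoiding_subgroups k Z L|)%N.
Proof.
move=> nsZG oZ p_pr; have [sZG nZG] := andP nsZG.
have join_over H : H \in avoiding_subgroups k Z G ->
    (H <*> Z)%G \in over_subgroups k.+1 Z G.
  rewrite !inE => /and3P[nsZH sHG /eqP oH].
  rewrite /= joing_subr join_subG sHG sZG /=.
  rewrite norm_joinEl ?(subset_trans sHG) // TI_cardMg ?oH ?oZ ?expnSr //.
  by rewrite setIC prime_TIg // oZ.
rewrite -sum1_card (partition_big (fun H => (H <*> Z)%G) _ join_over) /=.
apply: eq_bigr => L overL.
have /[!inE] /and3P[sZL sLG /eqP oL] : L \in over_subgroups k.+1 Z G := overL.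
rewrite -sum1_card; apply: eq_bigl => H.
apply/andP/idP => [[avH /eqP <-]|].
  by move: avH; rewrite !inE joing_subl => /and3P[-> _ ->].
move=> avL; have /[!inE] /and3P[nsZH sHL oH] := avL.
have avH : H \in avoiding_subgroups k Z G by rewrite inE nsZH (subset_trans sHL).
split.
  by move: avH; rewrite inE.
rewrite -val_eqE /= eqEcard join_subG sHL sZL /= oL.
by move: (join_over H avH); rewrite inE => /and3P[_ _ /eqP /= ->].
Qed.

End Counting.

(** * Isomorphism invariance and elementary abelian 2-groups *)

Lemma isog_nsubgroups (aT rT : finGroupType) (G : {group aT}) (K : {group rT}) p k :
  G \isog K -> nsubgroups_of_order p k G = nsubgroups_of_order p k K.
Proof.
have le (aT' rT' : finGroupType) (G' : {group aT'}) (K' : {group rT'}) :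
    G' \isog K' -> (nsubgroups_of_order p k G' <= nsubgroups_of_order p k K')%N.
  case/isogP=> f injf <-; rewrite /nsubgroups_of_order.
  set S := [set H | _].
  have injS : {in S &, injective (fun H : {group aT'} => (f @* H)%G)}.
    move=> H1 H2; rewrite !inE => /andP[sH1 _] /andP[sH2 _] /(congr1 val) /= eqH.
    by apply/val_inj/(injm_morphim_inj injf sH1 sH2).
  rewrite -(card_in_imset injS); apply/subset_leq_card/subsetP => _ /imsetP[H + ->].
  rewrite !inE => /andP[sHG oH].
  by rewrite /= morphimS //= card_injm.
by move=> isoGK; apply/eqP; rewrite eqn_leq !le // isog_sym.
Qed.

Lemma exponent2_abelem (gT : finGroupType) (G : {group gT}) :
  {in G, forall x, x ^+ 2 = 1} -> 2.-abelem G.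
Proof.
move=> sq1; have mul1 x : x \in G -> x * x = 1 by move=> Gx; rewrite -(sq1 x Gx).
apply/abelemP => //; split=> //; apply/centsP => x Gx y Gy.
apply: (mulgI x); apply: (mulIg y).
by rewrite !mulgA mul1 // mul1g mul1 // -(mulgA (x * y)) mul1 // groupM.
Qed.

Lemma C2pow_abelem m : 2.-abelem [set: C2pow_gtype m].
Proof.
apply: exponent2_abelem => f _; apply/ffunP => i; rewrite expgS expg1 !ffunE.
by case: (f i) => [[|[|?]] ?]; apply: val_inj.
Qed.

Lemma card_C2pow m : #|[set: C2pow_gtype m]| = (2 ^ m)%N.
Proof. by rewrite cardsT card_ffun !card_ord. Qed.

(** This is the Gaussian binomial coefficient at [q = 2], kept as a subgroup count so that it can be
    compared through bijections. *)
Definition elem2_count n k := nsubgroups_of_order 2 k [set: C2pow_gtype n].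

Lemma nsubgroups_abelem (gT : finGroupType) (E : {group gT}) n k :
  2.-abelem E -> #|E| = (2 ^ n)%N ->
  nsubgroups_of_order 2 k E = elem2_count n k.
Proof.
move=> abE oE; apply: (@isog_nsubgroups _ _ E [set: C2pow_gtype n]%G).
by rewrite (isog_abelem_card _ abE) C2pow_abelem card_C2pow oE eqxx.
Qed.

Lemma nsubgroupsS (gT : finGroupType) (p k : nat) (G K : {group gT}) :
  G \subset K -> (nsubgroups_of_order p k G <= nsubgroups_of_order p k K)%N.
Proof.
move=> sGK; apply/subset_leq_card/subsetP => H; rewrite !inE => /andP[sHG ->].
by rewrite (subset_trans sHG).
Qed.

(** An inequality on [#|E|] suits the quotient of a centralizer whose index is only known to be at
    most 2. *)
Lemma nsubgroups_abelem_ge (gT : finGroupType) (E : {group gT}) n k :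
  2.-abelem E -> (2 ^ n <= #|E|)%N ->
  (elem2_count n k <= nsubgroups_of_order 2 k E)%N.
Proof.
move=> abE leE; have pE := abelem_pgroup abE.
have len : (n <= logn 2 #|E|)%N by rewrite (card_pgroup pE) leq_exp2l in leE.
have [F [sFE _ oF]] := normal_pgroup pE (normal_refl E) len.
by rewrite -(nsubgroups_abelem _ F n k (abelemS sFE abE) oF) nsubgroupsS.
Qed.

(* The complements of a subgroup Z of order 2 in an elementary abelian group of
   order 2 ^ k.+2 are its subgroups of index 2, minus those that contain Z. *)
Definition elem2_complements k :=
  (elem2_count k.+2 k.+1 - elem2_count k.+1 k)%N.

(** * Elementary abelian groups relative to a subgroup of order 2 *)

Section QuotientByInvolution.
Variables (gT : finGroupType) (Z : {group gT}).
Hypothesis oZ : #|Z| = 2.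

Lemma card_quotient2 n (G : {group gT}) :
  Z <| G -> #|G| = (2 ^ n.+1)%N -> #|G / Z| = (2 ^ n)%N.
Proof.
by move=> nsZG oG; rewrite card_quotient ?normal_norm // -divgS ?normal_sub // oG oZ expnS mulKn.
Qed.

Lemma card_over_abelem n k (G : {group gT}) :
  Z <| G -> #|G| = (2 ^ n.+1)%N -> 2.-abelem (G / Z) ->
  #|over_subgroups gT 2 k.+1 Z G| = elem2_count n k.
Proof.
move=> nsZG oG abG; rewrite (@card_over_subgroups _ 2 1 k) //.
by rewrite (nsubgroups_abelem _ _ n) //= (card_quotient2 n).
Qed.

Lemma card_complements k (L : {group gT}) :
  2.-abelem L -> Z \subset L -> #|L| = (2 ^ k.+2)%N ->
  #|avoiding_subgroups gT 2 k.+1 Z L| = elem2_complements k.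
Proof.
move=> abL sZL oL; have nsZL : Z <| L by rewrite -sub_abelian_normal ?(abelem_abelian abL).
rewrite /elem2_complements -(nsubgroups_abelem _ L k.+2) //.
rewrite (nsubgroups_split gT 2 k.+1 Z) (card_over_abelem k.+1) ?addKn //.
exact: quotient_abelem.
Qed.

Lemma card_avoiding_abelem n k (E : {group gT}) :
  2.-abelem E -> Z \subset E -> #|E| = (2 ^ n.+1)%N ->
  #|avoiding_subgroups gT 2 k.+1 Z E| = (elem2_count n k.+1 * elem2_complements k)%N.
Proof.
move=> abE sZE oE; have nsZE : Z <| E by rewrite -sub_abelian_normal ?(abelem_abelian abE).
rewrite card_avoiding_subgroups // -(card_over_abelem n k.+1 E) ?quotient_abelem //.
rewrite -sum_nat_const; apply: eq_bigr => L; rewrite inE => /and3P[sZL sLE /eqP oL].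
by rewrite card_complements ?(abelemS sLE).
Qed.

End QuotientByInvolution.

(** * The upper bound when the Frattini subgroup has order 2 *)

Section PhiOrder2.
Variables (gT : finGroupType) (G : {group gT}) (m : nat).
Hypothesis oG : #|G| = (2 ^ m.+3)%N.
Hypothesis oPhi : #|'Phi(G)| = 2.

Let Z := 'Phi(G)%G.

Let pG : 2.-group G. Proof. by rewrite /pgroup oG pnatX. Qed.

Let nsZG : Z <| G. Proof. exact: Phi_normal. Qed.

(** The map [F], sending [L] to [L <*> A] together with one bit, is injective on the set being
    counted. The term for [C] stays on the left to avoid truncated subtraction. *)
Lemma card_abelem_over_Phi k :
  (#|[set L in over_subgroups gT 2 k.+2 Z G | 2.-abelem (L : {group gT})]|
     + elem2_count m k.+1 <= 2 * elem2_count m.+1 k.+1)%N.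
Proof.
have sqZ x : x \in G -> x ^+ 2 \in Z.
  move=> Gx; have sMZ : 'Mho^1(G) \subset Z by rewrite /= (Phi_joing pG) joing_subr.
  exact: subsetP sMZ _ (Mho_p_elt 1 Gx (mem_p_elt pG Gx)).
have commZ x y : x \in G -> y \in G -> [~ x, y] \in Z.
  move=> Gx Gy; rewrite /= (Phi_joing pG) mem_gen // inE; apply/orP; left.
  exact: mem_commg.
have [a Ga a2] : exists2 a, a \in G & a ^+ 2 != 1.
  have Phi_gt1 : (1 < #|'Phi(G)|)%N by rewrite oPhi.
  apply/exists_inP; apply: contraLR Phi_gt1 => /exists_inPn a2.
  rewrite cardG_gt1 negbK (trivg_Phi pG); apply: exponent2_abelem => x Gx.
  by apply/eqP; have := a2 x Gx; rewrite negbK.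
have defZ : <[a ^+ 2]> = Z.
  apply/eqP; rewrite eqEcard cycle_subG sqZ //= oPhi -orderE.
  by rewrite ltn_neqAle eq_sym order_eq1 a2 order_gt0.
have oa2 : #[a ^+ 2] = 2 by rewrite orderE defZ.
have inZ x : x \in Z -> x = 1 \/ x = a ^+ 2.
  rewrite -defZ => /cycleP[i ->]; rewrite -(expg_mod_order) oa2.
  by case: (i %% 2)%N (ltn_pmod i (isT : 0 < 2)%N) => [|[|]] // _; [left|right].
pose A := <[a]>%G.
have sZA : Z \subset A by rewrite -defZ cycleX.
have sAG : A \subset G by rewrite cycle_subG.
have oA : #|A| = (2 ^ 2)%N.
  by rewrite -[LHS]orderE (orderXpfactor (p := 2) (k := 1) oa2).
have nsAG : A <| G.
  apply: sub_der1_normal => //; apply: subset_trans sZA.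
  by rewrite /= (Phi_joing pG) joing_subl.
pose C := 'C_G[a]%G.
have sCG : C \subset G := subsetIl _ _.
have sAC : A \subset C by rewrite cycle_subG inE Ga cent1id.
have nsAC : A <| C := normalS sAC sCG nsAG.
have abGA : 2.-abelem (G / A).
  rewrite -trivg_Phi ?quotient_pgroup // -(quotient_Phi pG) ?normal_norm //.
  by rewrite -subG1 quotient_sub1 // (subset_trans (Phi_sub _)) ?normal_norm.
(* The commutator [[~ a, x]] lies in [Z], whose only elements are [1] and [a ^+ 2], and it is
   nontrivial for [x] outside [C]. So [a] has at most two conjugates, which bounds the index of
   [C]. *)
have conj_a x : x \in G -> x \notin C -> a ^ x = a * a ^+ 2.
  move=> Gx; rewrite inE Gx /= -(mulKVg a (a ^ x)) -commgEl.
  move=> nCx; congr (a * _); case: (inZ _ (commZ a x Ga Gx)) => // ax1; case/cent1P: nCx.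
  by apply/commute_sym/commgP/eqP.
have iC : (#|G : C| <= 2)%N.
  rewrite index_cent1.
  apply: (@leq_trans #|[set a; a * a ^+ 2]|); last by rewrite cards2; case: eqP.
  apply/subset_leq_card/subsetP => _ /imsetP[x Gx ->].
  rewrite !inE; have [Cx|nCx] := boolP (x \in C); last by rewrite conj_a // eqxx orbT.
  by move: Cx; rewrite inE => /andP[_ /cent1P/commute_sym/commgP/conjg_fixP ->]; rewrite eqxx.
have card_over : #|over_subgroups gT 2 k.+3 A G| = elem2_count m.+1 k.+1.
  rewrite (@card_over_subgroups _ 2 2 k.+1) // (nsubgroups_abelem _ _ m.+1) //=.
  by rewrite card_quotient ?normal_norm // -divgS // oG oA (expnD 2 2 m.+1) mulKn.
have card_overC : (elem2_count m k.+1 <= #|over_subgroups gT 2 k.+3 A C|)%N.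
  rewrite (@card_over_subgroups _ 2 2 k.+1) //.
  apply: nsubgroups_abelem_ge; first by rewrite (abelemS _ abGA) ?quotientS.
  rewrite card_quotient ?normal_norm // -divgS // oA leq_divRL // -expnD addn2.
  have := Lagrange sCG; rewrite oG => eC.
  by rewrite -(leq_pmul2r (isT : 0 < 2)%N) -expnSr -eC leq_mul2l iC orbT.
(* When [P] lies in [C], [repr] returns the default [1], which is in every [L]; the first conjunct
   in [F] forces the bit to [false] in that case. *)
pose pt (P : {group gT}) := repr (P :\: C).
pose F (L : {group gT}) :=
  ((L <*> A)%G, ~~ (L <*> A \subset C) && (pt (L <*> A)%G \in L)).
set N := [set L in _ | _].
have mulLA L : L \in N -> L <*> A = L * A.
  by rewrite !inE => /andP[/and3P[_ sLG _] _]; rewrite norm_joinEl ?(subset_trans sLG) ?normal_norm.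
have sqL L x : L \in N -> x \in L -> x ^+ 2 = 1.
  by rewrite inE => /andP[_ /abelemP[] // _]; apply.
(* As [a ^+ 2] is in [L], the product is the union of [L] and its coset by [a]. *)
have coset2 L x : L \in N -> x \in L <*> A -> x \in L \/ x * a^-1 \in L.
  move=> NL; rewrite mulLA // => /mulsgP[y _ Ly /cycleP[i ->] ->].
  have sZL : Z \subset L by case/setIdP: NL; rewrite inE => /and3P[].
  have La2 j : (a ^+ 2) ^+ j \in L by rewrite groupX // (subsetP sZL) // sqZ.
  rewrite -(odd_double_half i) expgD -muln2 mulnC expgM.
  case: (odd i); [right|left]; last by rewrite expg0 mul1g groupM.
  by rewrite expg1 -(mulgA y) groupM // (commuteX _ (commuteX 2 (commute_refl a))) mulgK.
have join_over L : L \in N -> (L <*> A)%G \in over_subgroups gT 2 k.+3 A G.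
  move=> NL; have := NL; rewrite inE => /andP[+ abL]; rewrite inE => /and3P[sZL sLG /eqP oL].
  rewrite inE joing_subr join_subG sLG sAG /= mulLA //.
  (* The order is even and divides 4; it is not 4, because [a ^+ 2 != 1] while squares in [L] are
     trivial. *)
  have oLA : #|L :&: A| = 2.
    have : 2 %| #|L :&: A| by rewrite -oPhi cardSg // subsetI sZL.
    have : #|L :&: A| %| 4 by rewrite (_ : 4 = #|A|)%N // cardSg ?subsetIr.
    have : #|L :&: A| != 4.
      apply: contraNneq a2 => o4; apply/eqP/(sqL L) => //.
      have /eqP : L :&: A == A by rewrite eqEcard subsetIr o4 oA.
      by move/setIidPr; rewrite cycle_subG.
    by case: #|_| => [|[|[|[|[|?]]]]] // _ /dvdn_leq.
  have := mul_cardG L A; rewrite oLA oL oA -expnD addn2 => e.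
  by rewrite -(eqn_pmul2r (isT : 0 < 2)%N) -e -expnSr.
have sub_F L1 L2 : L1 \in N -> L2 \in N -> F L1 = F L2 -> L1 \subset L2.
  move=> N1 N2 [eqLA eqb]; have sG L : L \in N -> L \subset G.
    by rewrite !inE => /andP[/and3P[]].
  (* Otherwise [x = y a] with [y] in [L2], whence [x ^+ 2 = a ^+ 2 != 1]. *)
  have cent_sub x : x \in L1 -> x \in C -> x \in L2.
    move=> L1x; rewrite inE => /andP[_ /cent1P/commute_sym cxa].
    have : x \in L2 <*> A by rewrite -eqLA mem_gen // inE L1x.
    case/(coset2 _ _ N2) => // /(sqL _ _ N2)/eqP.
    rewrite expgMn; last exact/commuteV/commute_sym.
    by rewrite (sqL _ _ N1 L1x) mul1g expgVn eq_invg1 (negbTE a2).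
  apply/subsetP => x L1x; have [/cent_sub->//|nCx] := boolP (x \in C).
  have Px : x \in L1 <*> A by rewrite mem_gen // inE L1x.
  have nsPC : ~~ (L1 <*> A \subset C) by apply: contraNN nCx => /subsetP->.
  have /setDP[Pq nCq] : pt (L1 <*> A)%G \in (L1 <*> A) :\: C.
    by apply: (mem_repr x); rewrite inE nCx.
  have P2q : pt (L1 <*> A)%G \in L2 <*> A by rewrite -eqLA.
  have eqLAG : (L2 <*> A)%G = (L1 <*> A)%G by apply: val_inj.
  move: eqb; rewrite eqLAG -eqLA nsPC /=; set q := pt _ in Pq nCq P2q * => eqb.
  (* Equal bits put [q] in both groups or in neither; in the latter case [coset2] puts [q * a^-1] in
     both. *)
  have [y [L1y L2y nCy]] : exists y, [/\ y \in L1, y \in L2 & y \notin C].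
    have [L1q|nL1q] := boolP (q \in L1); first by exists q; rewrite -eqb.
    case: (coset2 _ _ N1 Pq) => [|L1q]; first by rewrite (negbTE nL1q).
    case: (coset2 _ _ N2 P2q) => [|L2q]; first by rewrite -eqb (negbTE nL1q).
    exists (q * a^-1); split=> //; rewrite groupMr // groupV.
    by rewrite -cycle_subG.
  (* Both [x] and [y] conjugate [a] to [a * a ^+ 2], so [x * y^-1] centralizes [a] and [cent_sub]
     applies to it. *)
  rewrite -(mulgKV y x); apply: groupM => //.
  apply: cent_sub; first by apply: groupM; rewrite ?groupV.
  have [Gx Gy] := (subsetP (sG _ N1) x L1x, subsetP (sG _ N1) y L1y).
  apply/setIP; split; first by apply: groupM; rewrite ?groupV.
  apply/cent1P/commute_sym/commgP/conjg_fixP.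
  by rewrite conjgM conj_a // -(conj_a y) // conjgK.
have injF : {in N &, injective F}.
  by move=> L1 L2 N1 N2 eqF; apply/val_inj/eqP; rewrite eqEsubset !sub_F.
pose S := over_subgroups gT 2 k.+3 A G.
pose SC := over_subgroups gT 2 k.+3 A C.
have sSC : SC \subset S.
  by apply/subsetP => P; rewrite !inE => /and3P[-> sPC ->]; rewrite (subset_trans sPC).
(* The bit [true] occurs only over those [P] that are not inside [C]. *)
have F_sub : F @: N \subset
    [set (P, false) | P in S] :|: [set (P, true) | P in S :\: SC].
  apply/subsetP => _ /imsetP[L NL ->]; have SP := join_over L NL.
  rewrite /F inE; have [sPC|nsPC] := boolP (L <*> A \subset C).
    by apply/orP; left; apply/imsetP; exists (L <*> A)%G.
  case: (pt _ \in L); apply/orP; [right|left]; apply/imsetP; exists (L <*> A)%G => //.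
  by rewrite in_setD SP andbT; apply: contraNN nsPC; rewrite inE => /and3P[].
have leN : (#|N| <= #|S| + (#|S| - #|SC|))%N.
  rewrite -(card_in_imset injF).
  apply: leq_trans (subset_leq_card F_sub) _; apply: leq_trans (leq_card_setU _ _) _.
  apply: leq_add; rewrite ?leq_imset_card // (leq_trans (leq_imset_card _ _)) //.
  by rewrite cardsD (setIidPr sSC).
rewrite mul2n -addnn -card_over; apply: leq_trans (leq_add leN card_overC) _.
by rewrite -addnA subnK // subset_leq_card.
Qed.

(** Only elementary abelian [L] contribute: if [H] avoids [Z], then ['Phi(H)] lies in [Z :&: H = 1],
    so [H] is elementary abelian, and so is [L = Z \x H] because [Z] is central. *)
Lemma nsubgroups_Phi2_le k :
  (nsubgroups_of_order 2 k.+1 G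
   <= elem2_count m.+2 k + elem2_complements k
      * (2 * elem2_count m.+1 k.+1 - elem2_count m k.+1))%N.
Proof.
have abGZ : 2.-abelem (G / Z).
  by rewrite -trivg_Phi ?quotient_pgroup // -(quotient_Phi pG) ?normal_norm // trivg_quotient.
rewrite (nsubgroups_split gT 2 k.+1 Z) (card_over_abelem _ _ oPhi m.+2) //.
rewrite leq_add2l card_avoiding_subgroups //.
rewrite (bigID (fun L : {group gT} => 2.-abelem L)) /= [X in (_ + X)%N]big1 ?addn0; last first.
  move=> L /andP[+ nabL]; rewrite inE => /and3P[sZL sLG /eqP oL].
  apply/eqP; rewrite cards_eq0 -subset0; apply/subsetP => H; rewrite inE => /and3P[nsZH sHL oH].
  have pL := pgroupS sLG pG.
  case/negP: nabL; have tiHZ : Z :&: H = 1 by rewrite prime_TIg ?oPhi.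
  have sZGC : Z \subset 'Z(G).
    apply: prime_meetG; rewrite ?oPhi // meet_center_nil ?(pgroup_nil pG) //.
    by rewrite -cardG_gt1 oPhi.
  have abH : 2.-abelem H.
    rewrite -trivg_Phi ?(pgroupS sHL pL) // -subG1 -tiHZ subsetI Phi_sub andbT.
    exact: PhiS pG (subset_trans sHL sLG).
  have defL : Z \x H = L.
    rewrite dprodE //.
      apply/eqP; rewrite eqEcard mul_subG //= TI_cardMg // oPhi (eqP oH) oL.
      by rewrite expnS.
    by rewrite (subset_trans (subset_trans sHL sLG)) // centsC (subset_trans sZGC) ?subsetIr.
  rewrite (dprod_abelem _ defL) abH andbT.
  by rewrite prime_abelem ?oPhi.
rewrite (eq_bigr (fun=> elem2_complements k)); last first.
  move=> L /andP[+ abL]; rewrite inE => /and3P[sZL sLG /eqP oL].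
  exact: (card_complements _ _ oPhi).
rewrite sum_nat_const mulnC leq_mul2l; apply/orP; right.
(* The same bound also shows that this subtraction is not truncated. *)
rewrite leq_subRL; last exact: leq_trans (leq_addl _ _) (card_abelem_over_Phi k).
rewrite addnC; apply: leq_trans (card_abelem_over_Phi k); rewrite leq_add2r.
by apply/eq_leq/eq_card => L; rewrite [RHS]inE unfold_in.
Qed.
End PhiOrder2.

(** * Replacing [G] by the product of [G / Z] and [Z] *)

(** Here [remgr K Z] is the projection of [L] to [Z] along [K]. An element killed by [coset Z] lies
    in [Z], where this projection is the identity, whence injectivity. *)
Lemma dprod_coset_remgr (gT : finGroupType) (K Z L : {group gT}) :
  K \x Z = L ->
  let f x := (coset Z x, remgr K Z x) in
  {in L &, {morph f : x y / x * y}} /\ {in L &, injective f}.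
Proof.
move=> defL f; have [nsKL nsZL] := dprod_normal2 defL.
have [_ mulKZ _ tiKZ] := dprodP defL.
have complZ : Z \in [complements to K in L] by apply/complP.
have nZL := subsetP (normal_norm nsZL).
have fM : {in L &, {morph f : x y / x * y}}.
  by move=> x y Lx Ly; rewrite /f (remgrM complZ) // morphM ?nZL.
split=> // x y Lx Ly; case=> eqc eqr.
have Zxy : x * y^-1 \in Z.
  apply: coset_idr; first by rewrite groupM ?groupV ?nZL.
  by rewrite morphM ?morphV ?groupV ?nZL //= eqc mulgV.
have : remgr K Z (x * y^-1 * y) = x * y^-1 * remgr K Z y.
  by rewrite (remgrM complZ) ?(remgr_id tiKZ Zxy) // groupM ?groupV.
rewrite mulgKV eqr -[LHS]mul1g => /mulIg e.
by rewrite -(mulgKV y x) -e mul1g.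
Qed.

(* Given one complement [Hc] of [Z] in [HZ], the isomorphism of [HZ] with
   [HZ / Z x Z] along [Hc] embeds all other complements of [Z] in [HZ]. *)
Lemma nsubgroups_quotient_prod (gT : finGroupType) (p k : nat) (G Z : {group gT}) :
  Z \subset 'Z(G) -> #|Z| = p -> prime p ->
  (nsubgroups_of_order p k G <= nsubgroups_of_order p k (setX (G / Z) Z))%N.
Proof.
move=> sZC oZ p_pr; have [sZG] := subsetIP sZC; rewrite centsC => cZG.
have nZG : G \subset 'N(Z) := subset_trans cZG (cent_sub _).
(* The choice depends on [L] alone, so all [H] with the same [H <*> Z] share one map [f]. For such
   [L] with [H] avoiding [Z] the default is not reached, since [H] itself qualifies. *)
pose Hc (L : {group gT}) : {group gT} := odflt 1%G [pick K : {group gT} | K \x Z == L].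
pose f (L : {group gT}) (x : gT) := (coset Z x, remgr (Hc L) Z x).
pose F (H : {group gT}) : {set coset_of Z * gT} :=
  if Z \subset H then setX (H / Z) Z else f (H <*> Z)%G @: H.
rewrite /nsubgroups_of_order; set S := [set H | _]; set T := [set H | _].
have nZS H : H \in S -> H \subset 'N(Z).
  by rewrite inE => /andP[sHG _]; apply: subset_trans nZG.
have HcP H : H \in S -> ~~ (Z \subset H) -> Hc (H <*> Z)%G \x Z = (H <*> Z)%G.
  move=> SH nsZH; rewrite /Hc; case: pickP => [K /eqP //|/(_ H)/eqP[]].
  rewrite dprodE /= ?norm_joinEl ?nZS //.
    by rewrite centsC; move: SH; rewrite inE => /andP[/subset_trans->].
  by rewrite setIC prime_TIg ?oZ.
have card_F H : H \in S -> #|F H| = (p ^ k)%N.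
  move=> SH; have := SH; rewrite inE => /andP[_ /eqP <-]; rewrite /F.
  have [sZH|nsZH] := boolP (Z \subset H).
    by rewrite cardsX card_quotient ?nZS // mulnC Lagrange.
  have [_ injf] := dprod_coset_remgr _ _ _ _ (HcP H SH nsZH).
  by apply: card_in_imset => x y Hx Hy; apply: injf; rewrite mem_gen // inE (Hx, Hy).
have group_F H : H \in S -> group_set (F H).
  move=> SH; rewrite /F; have [sZH|nsZH] := boolP (Z \subset H); first exact: groupP.
  have [fM _] := dprod_coset_remgr _ _ _ _ (HcP H SH nsZH).
  have -> : f (H <*> Z)%G @: H = Morphism fM @* H.
    by rewrite morphimEsub ?joing_subl.
  exact: groupP.
have F_sub H : H \in S -> F H \subset setX (G / Z) Z.
  move=> SH; have := SH; rewrite inE => /andP[sHG _].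
  rewrite /F; have [sZH|nsZH] := boolP (Z \subset H); first by rewrite setXS ?quotientS.
  apply/subsetP => _ /imsetP[x Hx ->]; have /dprodP[_ mulL _ _] := HcP H SH nsZH.
  rewrite in_setX /= mem_quotient ?(subsetP sHG) //= mem_remgr // mulL.
  by rewrite mem_gen // inE Hx.
(* Thus [F H] determines [H / Z], and hence [H <*> Z]. *)
have F_fst H : H \in S -> fst @: F H = H / Z.
  move=> SH; rewrite /F; case: ifP => _; last by rewrite -imset_comp -imset_coset.
  apply/setP => u; apply/imsetP/idP => [[[v z] /setXP[Hv _] ->] //|Hu].
  by exists (u, 1); rewrite // in_setX Hu group1.
have injF : {in S &, injective F}.
  move=> H1 H2 S1 S2 eqF; have oS H : H \in S -> #|H| = (p ^ k)%N.
    by rewrite inE => /andP[_ /eqP].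
  have eqL : (H1 <*> Z)%G = (H2 <*> Z)%G.
    apply: val_inj => /=; rewrite !(joingC _ Z) -!quotientYK ?nZS //.
    by rewrite -!F_fst // eqF.
  (* If one of the groups contains [Z], it equals the common product with [Z], so it contains the
     other, which has the same order. *)
  have [sZ1|nsZ1] := boolP (Z \subset H1).
    apply/esym/val_inj/eqP; rewrite eqEcard !oS // leqnn andbT.
    by move/(congr1 val): eqL => /= /esym; rewrite (joing_idPl sZ1) => <-; apply: joing_subl.
  have [sZ2|nsZ2] := boolP (Z \subset H2).
    apply/val_inj/eqP; rewrite eqEcard !oS // leqnn andbT.
    by move/(congr1 val): eqL => /=; rewrite (joing_idPl sZ2) => <-; apply: joing_subl.
  have [_ injf] := dprod_coset_remgr _ _ _ _ (HcP H1 S1 nsZ1).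
  apply/val_inj/eqP; rewrite eqEcard !oS // leqnn andbT; apply/subsetP => x H1x.
  have : f (H1 <*> Z)%G x \in F H1 by rewrite /F (negPf nsZ1) imset_f.
  rewrite eqF /F (negPf nsZ2) -eqL => /imsetP[y H2y /injf->] //.
    by rewrite mem_gen // inE H1x.
  by rewrite eqL mem_gen // inE H2y.
(* Generation only serves to view the group set [F H] as a group; it leaves the set unchanged. *)
have injFG : {in S &, injective (fun H => <<F H>>%G)}.
  move=> H1 H2 S1 S2 /(congr1 val) /=.
  by rewrite !gen_set_id ?group_F //; apply: injF.
rewrite -(card_in_imset injFG); apply/subset_leq_card/subsetP => _ /imsetP[H SH ->].
by rewrite inE /= gen_set_id ?group_F // F_sub // card_F // eqxx.
Qed.

(** * The matching lower bound for the extremal group *)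

(** Inclusion-exclusion on the subgroups of [E1] and [E2] that avoid [Z]; those lying in both are
    the ones in [E1 :&: E2], which gives the subtracted term. *)
Lemma nsubgroups_ge (gT : finGroupType) (M Z E1 E2 : {group gT}) m k :
  #|M| = (2 ^ m.+3)%N -> #|Z| = 2 -> Z <| M -> 2.-abelem (M / Z) ->
  Z \subset E1 :&: E2 -> E1 \subset M -> E2 \subset M ->
  2.-abelem E1 -> 2.-abelem E2 ->
  #|E1| = (2 ^ m.+2)%N -> #|E2| = (2 ^ m.+2)%N -> #|E1 :&: E2| = (2 ^ m.+1)%N ->
  (elem2_count m.+2 k + elem2_complements k
      * (2 * elem2_count m.+1 k.+1 - elem2_count m k.+1)
   <= nsubgroups_of_order 2 k.+1 M)%N.
Proof.
move=> oM oZ nsZM abMZ sZE sE1 sE2 ab1 ab2 o1 o2 o12.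
have [sZ1 sZ2] := subsetIP sZE.
rewrite (nsubgroups_split gT 2 k.+1 Z M) (card_over_abelem _ _ oZ m.+2) // leq_add2l.
pose av (E : {set gT}) := avoiding_subgroups gT 2 k.+1 Z E.
have avS (E : {group gT}) : E \subset M -> av E \subset av M.
  move=> sEM; apply/subsetP => H; rewrite !inE => /and3P[-> sHE ->].
  by rewrite (subset_trans sHE).
have avI : av E1 :&: av E2 = av (E1 :&: E2).
  apply/setP => H; rewrite !inE subsetI.
  by do 3!case: (_ \subset _); case: (_ == _).
have := cardsUI (av E1) (av E2); rewrite avI /av.
rewrite (card_avoiding_abelem _ _ oZ m.+1) // (card_avoiding_abelem _ _ oZ m.+1) //.
rewrite (card_avoiding_abelem _ _ oZ m k (E1 :&: E2)%G) ?(abelemS (subsetIl _ _)) //.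
move=> eU; apply: (@leq_trans #|av E1 :|: av E2|); last first.
  by apply: subset_leq_card; rewrite subUset !avS.
by rewrite mulnBr mul2n -addnn mulnDr !(mulnC (elem2_complements k)) -eU addnK.
Qed.

(** With [x] of order 4 and [y] a reflection, [Z] is generated by [x ^+ 2], and the two four-groups
    are obtained by adjoining [y] and [x * y]. *)
Lemma D8_structure :
  exists Z F1 F2 : {group 'D_8},
    [/\ #|Z| = 2, Z <| [set: 'D_8], Z \subset F1 :&: F2, forall x, x ^+ 2 \in Z
      & [/\ 2.-abelem F1, 2.-abelem F2, #|F1| = 4, #|F2| = 4 & #|F1 :&: F2| = 2]].
Proof.
have isoD : [set: 'D_8] \isog [set: 'D_(2 ^ 3)] := isog_refl _.
have [[x y] genD _] := generators_2dihedral (isT : 1 < 3)%N isoD.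
have [_ _ ox X'y] := genD.
have [[_ X'2 X'inv] [derD _ _ _] _ _ _] := dihedral2_structure (isT : 1 < 3)%N genD isoD.
have ox2 : #[x ^+ 2] = 2 by rewrite orderXdiv ox.
have X'xy : x * y \in [set: 'D_8] :\: <[x]>.
  by move: X'y; rewrite !inE !andbT groupMl ?cycle_id.
pose F t := (<[x ^+ 2]> <*> <[t]>)%G.
have dF t : t \in [set: 'D_8] :\: <[x]> -> <[x ^+ 2]> \x <[t]> = F t.
  move=> X't; rewrite dprodEY //.
    rewrite cent_cycle cycle_subG; apply/cent1P/commute_sym/commgP/conjg_fixP.
    by rewrite (X'inv _ _ (mem_cycle _ _) X't) invg_expg ox2.
  rewrite setIC prime_TIg -?orderE ?X'2 // cycle_subG.
  apply/negP => /(subsetP (cycleX _ _)) Xt.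
  by case/setDP: X't; rewrite Xt.
have abF t : t \in [set: 'D_8] :\: <[x]> -> 2.-abelem (F t).
  move=> X't; rewrite (dprod_abelem _ (dF t X't)).
  by rewrite !prime_abelem // -orderE ?X'2.
have oF t : t \in [set: 'D_8] :\: <[x]> -> #|F t| = 4.
  by move=> X't; rewrite -(dprod_card (dF t X't)) -!orderE ox2 X'2.
exists <[x ^+ 2]>%G, (F y), (F (x * y)); split.
- by rewrite -orderE.
- by have := der_normal 1 [set: 'D_8]%G; rewrite derD.
- by rewrite subsetI !joing_subl.
- move=> t; have [/cycleP[i ->]|nXt] := boolP (t \in <[x]>).
    by rewrite -expgM mulnC expgM mem_cycle.
  have /eqP -> : t ^+ 2 == 1 by rewrite -order_dvdn X'2 // inE nXt inE.
  exact: group1.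
split; rewrite ?abF ?oF //.
have : 2 %| #|F y :&: F (x * y)| by rewrite -{1}ox2 orderE cardSg // subsetI !joing_subl.
have : #|F y :&: F (x * y)| %| 4 by have := cardSg (subsetIl (F y) (F (x * y))); rewrite oF.
(* Otherwise [F (x * y)] would contain [y], hence also [x], whose square is nontrivial. *)
have : #|F y :&: F (x * y)| != 4.
  apply/negP => /eqP o4; have /eqP/setIidPl sF : F y :&: F (x * y) == F y.
    by rewrite eqEcard subsetIl o4 oF.
  have Fxy : x * y \in F (x * y) by rewrite mem_gen // inE cycle_id orbT.
  have Fy : y \in F (x * y) by rewrite (subsetP sF) // mem_gen // inE cycle_id orbT.
  have Fx : x \in F (x * y) by rewrite -(groupMr _ Fy).
  have /abelemP[] // := abF _ X'xy.
  by move=> _ /(_ _ Fx)/eqP; rewrite -order_eq1 ox2.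
by case: #|_| => [|[|[|[|[|?]]]]] // _ /dvdn_leq.
Qed.

(** The four-groups of ['D_8] times the whole elementary abelian factor serve as [E1] and [E2], with
    [setX Z 1] as the subgroup of order 2. *)
Lemma D8xC2pow_ge m k :
  (elem2_count m.+2 k + elem2_complements k
      * (2 * elem2_count m.+1 k.+1 - elem2_count m k.+1)
   <= nsubgroups_of_order 2 k.+1 [set: D8xC2pow_gtype m])%N.
Proof.
have [Z [F1 [F2 [oZ nsZ sZF sqZ [ab1 ab2 o1 o2 o12]]]]] := D8_structure.
pose C := [set: C2pow_gtype m]%G.
have [sZ1 sZ2] := subsetIP sZF.
have sqC (f : C2pow_gtype m) : f ^+ 2 = 1.
  by have /abelemP[//|_ ->] := C2pow_abelem m; rewrite ?inE.
have sqX (u : D8xC2pow_gtype m) : u ^+ 2 = (u.1 ^+ 2, 1).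
  by rewrite -(sqC u.2).
have abX (F : {group 'D_8}) : 2.-abelem F -> 2.-abelem (setX F C).
  case/abelemP => // _ sqF; apply: exponent2_abelem => -[u f] /setXP[Fu _].
  by rewrite sqX sqF.
have nZ : [set: D8xC2pow_gtype m] \subset 'N(setX Z 1).
  apply/subsetP => u _; rewrite inE; apply/subsetP => _ /imsetP[[v f] /setXP[Zv /set1P v1] ->].
  rewrite inE; apply/andP; split; last by rewrite (_ : _.2 = f ^ u.2) // (v1 : f = 1) conj1g set11.
  have nZu := subsetP (normal_norm nsZ) u.1 (in_setT _).
  by rewrite (_ : _.1 = v ^ u.1) // memJ_norm.
apply: (@nsubgroups_ge _ [set: D8xC2pow_gtype m]%G (setX Z 1)%G (setX F1 C)%G (setX F2 C)%G).
- have oD : #|'D_8| = (2 ^ 3)%N := card_2dihedral (isT : 1 < 3)%N.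
  by rewrite cardsT card_prod -[X in (X * _)%N]cardsT oD -cardsT card_C2pow -expnD.
- by rewrite /= cardsX oZ cards1.
- by rewrite /normal subsetT.
- apply: exponent2_abelem => _ /morphimP[u nu _ ->].
  rewrite -morphX //; apply: coset_id; rewrite sqX in_setX group1 andbT.
  exact: sqZ.
- by rewrite subsetI !setXS ?sub1G.
- exact: subsetT.
- exact: subsetT.
- exact: abX.
- exact: abX.
- by rewrite cardsX o1 card_C2pow !expnS mulnA.
- by rewrite cardsX o2 card_C2pow !expnS mulnA.
have -> : setX F1 C :&: setX F2 C = setX (F1 :&: F2) C.
  by apply/setP => u; rewrite !inE !andbT.
by rewrite cardsX o12 card_C2pow expnS.
Qed.

(** * Frattini subgroups of products and the induction *)

(** The embeddings [pairg1] and [pair1g] turn the external product into an internal one, to which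
    [Phi_cprod] applies. *)
Lemma card_Phi_setX (gT1 gT2 : finGroupType) (p : nat)
    (A : {group gT1}) (B : {group gT2}) :
  p.-group A -> p.-group B ->
  #|'Phi(setX A B)| = (#|'Phi(A)| * #|'Phi(B)|)%N.
Proof.
move=> pA pB; have pX : p.-group (setX A B) by rewrite /pgroup cardsX pnatM; apply/andP.
have defX : (@pairg1 gT1 gT2 @* A) \x (@pair1g gT1 gT2 @* B) = setX A B.
  by rewrite morphim_pairg1 morphim_pair1g; apply: setX_dprod.
have := Phi_cprod pX (dprodWcp defX).
rewrite -(morphim_Phi _ pA) ?subsetT // -(morphim_Phi _ pB) ?subsetT // => defPhi.
rewrite -(card_injm (injm_pairg1 gT1 gT2) (subsetT _)).
rewrite -(card_injm (injm_pair1g gT1 gT2) (subsetT _)).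
have [_ _ _ tiX] := dprodP defX.
apply/esym/dprod_card; rewrite dprodEcp //.
by apply/trivgP; rewrite -tiX setISS ?morphimS ?Phi_sub.
Qed.

(** This makes the induction measure drop: [Z] has trivial Frattini subgroup, and that of [G / Z] is
    ['Phi(G) / Z]. *)
Lemma card_Phi_quotient_prod (gT : finGroupType) (p : nat) (G Z : {group gT}) :
  p.-group G -> Z \subset 'Phi(G) -> #|Z| = p -> prime p -> G \subset 'N(Z) ->
  (#|'Phi(setX (G / Z) Z)| * p)%N = #|'Phi(G)|.
Proof.
move=> pG sZPhi oZ p_pr nZG.
have pZ := pgroupS (subset_trans sZPhi (Phi_sub G)) pG.
have /eqP Phi1 : 'Phi(Z) == 1 by rewrite (trivg_Phi pZ) prime_abelem ?oZ.
rewrite (card_Phi_setX _ _ _ _ _ (quotient_pgroup Z pG) pZ) Phi1 cards1 muln1.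
rewrite -(quotient_Phi pG) // card_quotient ?(subset_trans (Phi_sub G)) //.
by rewrite -oZ mulnC Lagrange.
Qed.

(** Strong induction on [#|'Phi(G)|] over all group types, since the reduction step changes the
    ambient type. *)
Lemma nsubgroups_le_D8xC2pow m k (gT : finGroupType) (G : {group gT}) :
  #|G| = (2 ^ m.+3)%N -> ~~ 2.-abelem G ->
  (nsubgroups_of_order 2 k.+1 G
   <= nsubgroups_of_order 2 k.+1 [set: D8xC2pow_gtype m])%N.
Proof.
have [N] := ubnP #|'Phi(G)|; elim: N => // N IHN in gT G *.
move=> /ltnSE lePhi oG nabG.
have pG : 2.-group G by rewrite /pgroup oG pnatX.
have ntPhi : 'Phi(G) != 1 by rewrite (trivg_Phi pG).
have ntPZ : 'Phi(G) :&: 'Z(G) != 1 by rewrite meet_center_nil ?(pgroup_nil pG) ?Phi_normal.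
have pPZ : 2.-group ('Phi(G) :&: 'Z(G)).
  by apply: pgroupS pG; rewrite subIset ?Phi_sub.
have [_ dvd2 _] := pgroup_pdiv pPZ ntPZ; have [z Pz oz] := Cauchy (isT : prime 2) dvd2.
have [sZP sZC] : <[z]> \subset 'Phi(G) /\ <[z]> \subset 'Z(G).
  by apply/andP; rewrite -subsetI cycle_subG.
have [oPhi|nPhi2] := eqVneq #|'Phi(G)| 2.
  exact: leq_trans (nsubgroups_Phi2_le _ _ _ oG oPhi k) (D8xC2pow_ge m k).
apply: leq_trans (nsubgroups_quotient_prod _ 2 _ G <[z]>%G sZC oz isT) _.
have nZG : G \subset 'N(<[z]>).
  by rewrite cents_norm // centsC (subset_trans sZC) ?subsetIr.
have ePhi := card_Phi_quotient_prod _ _ G <[z]>%G pG sZP oz isT nZG.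
have oX : #|setX (G / <[z]>) <[z]>| = (2 ^ m.+3)%N.
  by rewrite cardsX (card_quotient nZG) mulnC Lagrange // (subset_trans sZP) ?Phi_sub.
apply: IHN => //=.
  apply: leq_trans lePhi; rewrite -ePhi ltn_Pmulr //.
rewrite -(@trivg_Phi _ 2 (setX (G / <[z]>) <[z]>)%G); last by rewrite /pgroup oX pnatX.
(* If the new group were elementary abelian, ['Phi(G)] would have order 2, the case already
   settled. *)
apply: contraNneq nPhi2 => Phi1; rewrite -ePhi /= Phi1 cards1.
by [].
Qed.

Theorem theorem1p1 (gT : finGroupType) (G : {group gT}) (n : nat) :
  #|G| = (2 ^ n)%N -> (3 <= n)%N -> ~~ 2.-abelem G ->
  forall k : nat, (k <= n)%N ->
  (nsubgroups_of_order 2 k G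
     <= nsubgroups_of_order 2 k [set: D8xC2pow_gtype (n - 3)])%N.
Proof.
move=> oG n3 nabG [|k] _; last first.
  by apply: nsubgroups_le_D8xC2pow; rewrite // -addn3 subnK.
(* For [k = 0] both sides count just the trivial subgroup. *)
apply: (@leq_trans #|[set 1%G : {group gT}]|).
  apply/subset_leq_card/subsetP => H; rewrite !inE -trivg_card1 => /andP[_ /eqP H1].
  by apply/eqP/val_inj.
rewrite cards1 card_gt0; apply/set0Pn; exists 1%G.
by rewrite inE sub1G cards1.
Qed.
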